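(* Let $\mathbb{O}$ be the split octonion algebra over $\mathbb{F}_2$. The incidence structure $\mathcal{U}=(\mathcal{D},\mathcal{X},<)$ is isomorphic to the Hermitian unital of order $3$.
   Context: Octonion algebra. Let $\mathbb{F}$ be a field and $\mathbb{H}=\mathbb{F}^{2\times2}$, with norm $N=\det$ and standard involution $\bar a=\operatorname{tr}(a)\mathbf 1-a$ (the adjugate of $a$). The split octonion algebra over $\mathbb{F}$ is $\mathbb{O}=\mathbb{H}\oplus\mathbb{H}w$ with multiplication $(a+xw)(b+yw)=ab+\bar y x+(ya+x\bar b)w$ for $a,b,x,y\in\mathbb{H}$, norm $N(a+xw)=N(a)-N(x)$ and standard involution $\overline{a+xw}=\bar a-xw$. The polar form of $N$ is $(u|v)=N(u+v)-N(u)-N(v)$, and $\perp$ refers to this form. $\mathbb{F}$ is identified with $\mathbb{F}\mathbf 1$. Here $\mathbb{F}=\mathbb{F}_2$. The incidence structure. $\mathcal{D}$ is the set of all $2$-dimensional subalgebras $D$ of $\mathbb{O}$ such that $N|_D$ is anisotropic and has non-trivial polarization (for $\mathbb{F}=\mathbb{F}_2$: the subalgebras isomorphic to the field $\mathbb{F}_4$). For $D\in\mathcal{D}$, left multiplication makes $\mathbb{O}$ a vector space over $D$. $\mathcal{X}$ is the set of all subalgebras of the form $D+Dz$ with $D\in\mathcal{D}$, $z\in D^\perp$, $z^2=0\neq z$. In $\mathcal{U}=(\mathcal{D},\mathcal{X},<)$ the points are the elements of $\mathcal{D}$, the blocks are the elements of $\mathcal{X}$, and $D\in\mathcal{D}$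 is incident with $X\in\mathcal{X}$ if $D<X$. Hermitian unital of order $3$. Let $h$ be a non-degenerate Hermitian form on $\mathbb{F}_9^3$ with respect to the generator of $\operatorname{Gal}(\mathbb{F}_9|\mathbb{F}_3)$ (essentially unique). The points are the $1$-dimensional subspaces $P$ of $\mathbb{F}_9^3$ with $h|_P=0$; the blocks are induced by the $2$-dimensional subspaces on which the restriction of $h$ is non-degenerate (each such subspace is identified with the set of points contained in it). *)

(* Defs.v *)
From HB Require Import structures.
From mathcomp Require Import all_boot all_order all_algebra all_fingroup.
From mathcomp Require Import all_solvable all_field.
From mathcomp Require Import classical_sets functions.

Set Implicit Arguments.
Unset Strict Implicit.
Unset Printing Implicit Defensive.

Import GRing.Theory.
Local Open Scope classical_set_scope.
Local Open Scope ring_scope.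

(* Points and blocks are the elements of the sets [points] and [blocks]; the
   values of [incident] outside these sets are irrelevant. *)
Record incidence_structure := IncidenceStructure {
  point_type : Type;
  block_type : Type;
  points : set point_type;
  blocks : set block_type;
  incident : point_type -> block_type -> Prop }.

Arguments points : clear implicits.
Arguments blocks : clear implicits.

Definition isomorphic (S T : incidence_structure) : Prop :=
  exists (f : point_type S -> point_type T) (g : block_type S -> block_type T),
    [/\ set_bij (points S) (points T) f,
        set_bij (blocks S) (blocks T) g
      & forall p b, points S p -> blocks S b ->
          (incident p b <-> incident (f p) (g b))].

(* The pair (a, x) stands for a + xw.  The octonion product is [octmul] below;
   [u * v] would denote the componentwise product of pairs. *)
Definition octonion (F : fieldType) : Type := ('M[F]_2 * 'M[F]_2)%type.

HB.instance Definition _ (F : fieldType) :=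
  Vector.copy (octonion F) ('M[F]_2 * 'M[F]_2)%type.

Section Octonion.
Variable F : fieldType.
Implicit Types (a : 'M[F]_2) (u v z : octonion F) (A D X : {vspace octonion F}).

Definition quatconj a : 'M[F]_2 := (\tr a)%:M - a.

Definition octmul u v : octonion F :=
  (u.1 *m v.1 + quatconj v.2 *m u.2, v.2 *m u.1 + u.2 *m quatconj v.1).

Definition octnorm u : F := \det u.1 - \det u.2.

Definition octpolar u v : F := octnorm (u + v) - octnorm u - octnorm v.

(* The unit element is not required to lie in A.  For the members of [octD] and
   [octX] it does: each u satisfies u^2 = tr(u) u - N(u) 1, and N(u) is
   invertible for u <> 0 in an anisotropic subalgebra. *)
Definition subalgebra A : Prop := {in A &, forall u v, octmul u v \in A}.

Definition octD : set {vspace octonion F} :=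
  [set D | [/\ subalgebra D,
               \dim D = 2%N,
               {in D, forall u, octnorm u = 0 -> u = 0}
             & exists u v, [/\ u \in D, v \in D & octpolar u v != 0]]].

Definition octX : set {vspace octonion F} :=
  [set X | subalgebra X /\
     exists D z,
       [/\ octD D,
           {in D, forall d, octpolar z d = 0},
           octmul z z = 0,
           z != 0
         & forall u, u \in X <->
             exists d e, [/\ d \in D, e \in D & u = d + octmul e z]]].

Definition octU : incidence_structure :=
  @IncidenceStructure {vspace octonion F} {vspace octonion F} octD octX
    (fun D X => (D <= X)%VS && (D != X)).

End Octonion.

Section HermitianUnital.
Variables (K : fieldType) (theta : {rmorphism K -> K}).
Variable h : {hermitian_sym 'rV[K]_3 for theta}.
Implicit Types P L : {vspace 'rV[K]_3}.

Definition hermitian_points : set {vspace 'rV[K]_3} :=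
  [set P | \dim P = 1%N /\ {in P &, forall u v, h u v = 0}].

(* The radical of the restriction of h to L is the intersection of L with
   [orthov h L]. *)
Definition hermitian_blocks : set (set {vspace 'rV[K]_3}) :=
  [set [set P | hermitian_points P /\ (P <= L)%VS]
    | L in [set L | \dim L = 2%N /\ (L :&: orthov h L = 0)%VS]].

Definition hermitian_unital : incidence_structure :=
  @IncidenceStructure {vspace 'rV[K]_3} (set {vspace 'rV[K]_3})
    hermitian_points hermitian_blocks (fun P B => B P).

End HermitianUnital.

(* Main.v *)
(* Every member of D is {0, 1, u, u + 1} for some octonion u with trace and norm
   1, so there are 28 points on one side; on the other side there are 28 isotropic
   lines of F_9^3.  An explicit bijection between the two, found by computer
   search, maps the four points of each member of X onto the isotropic points of
   the hyperplane n^perp of a non-isotropic vector n.  To verify it by computation,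
   octonions over F_2 are encoded by eight bits, and vectors of K^3 by their
   coordinates with respect to an orthonormal basis, each coordinate being s + t i
   with i^2 = -1 and s, t in {0, 1, -1}; the generator of the Galois group maps i
   to -i.  Orthonormal bases exist because every non-zero element of F_3 is a norm
   from F_9. *)

Require Import Defs.
From mathcomp Require Import all_boot all_order all_algebra all_fingroup.
From mathcomp Require Import all_solvable all_field.
From mathcomp Require Import boolp classical_sets functions.
From mathcomp Require Import ring.

Set Implicit Arguments.
Unset Strict Implicit.
Unset Printing Implicit Defensive.

Import GRing.Theory.
Local Open Scope ring_scope.

(** * Computable models of the octonions and of the Hermitian plane *)

(** The bits are the entries of a 2 by 2 matrix, row by row. *)
Definition bquat : Type := bool * bool * bool * bool.
Definition boct : Type := bquat * bquat.

Definition bqadd (a b : bquat) : bquat :=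
  let: (a1, a2, a3, a4) := a in let: (b1, b2, b3, b4) := b in
  (a1 (+) b1, a2 (+) b2, a3 (+) b3, a4 (+) b4).

Definition bqmul (a b : bquat) : bquat :=
  let: (a1, a2, a3, a4) := a in let: (b1, b2, b3, b4) := b in
  ((a1 && b1) (+) (a2 && b3), (a1 && b2) (+) (a2 && b4),
   (a3 && b1) (+) (a4 && b3), (a3 && b2) (+) (a4 && b4)).

(** The adjugate swaps the diagonal entries and negates the other two; modulo 2 the signs vanish. *)
Definition bqconj (a : bquat) : bquat :=
  let: (a1, a2, a3, a4) := a in (a4, a2, a3, a1).

Definition bqdet (a : bquat) : bool :=
  let: (a1, a2, a3, a4) := a in (a1 && a4) (+) (a2 && a3).

Definition boadd (u v : boct) : boct := (bqadd u.1 v.1, bqadd u.2 v.2).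

Definition bomul (u v : boct) : boct :=
  (bqadd (bqmul u.1 v.1) (bqmul (bqconj v.2) u.2),
   bqadd (bqmul v.2 u.1) (bqmul u.2 (bqconj v.1))).

Definition bonorm (u : boct) : bool := bqdet u.1 (+) bqdet u.2.

Definition bopolar (u v : boct) : bool :=
  bonorm (boadd u v) (+) bonorm u (+) bonorm v.

Definition bo0 : boct :=
  ((false, false, false, false), (false, false, false, false)).
Definition bo1 : boct :=
  ((true, false, false, true), (false, false, false, false)).

Definition bquats : seq bquat :=
  let B := [:: false; true] in
  [seq (p, d) | p <- [seq (p, c) | p <- [seq (a, b) | a <- B, b <- B], c <- B],
    d <- B].

Definition bocts : seq boct := [seq (a, b) | a <- bquats, b <- bquats].

Fixpoint bospan (s : seq boct) : seq boct :=
  if s is u :: s' then bospan s' ++ map (boadd u) (bospan s') else [:: bo0].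

(* [None], [Some false] and [Some true] stand for 0, 1 and -1 in F_3. *)
Definition trit : Type := option bool.

Definition topp (s : trit) : trit := omap negb s.

Definition tadd (s t : trit) : trit :=
  match s, t with
  | None, _ => t
  | _, None => s
  | Some a, Some b => if a == b then Some (~~ a) else None
  end.

Definition tmul (s t : trit) : trit :=
  if (s, t) is (Some a, Some b) then Some (a (+) b) else None.

(* (s, t) stands for s + t i in F_9, where i^2 = -1. *)
Definition gf9 : Type := trit * trit.

Definition gadd (x y : gf9) : gf9 := (tadd x.1 y.1, tadd x.2 y.2).

Definition gmul (x y : gf9) : gf9 :=
  (tadd (tmul x.1 y.1) (topp (tmul x.2 y.2)),
   tadd (tmul x.1 y.2) (tmul x.2 y.1)).

Definition gconj (x : gf9) : gf9 := (x.1, topp x.2).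

Definition g0 : gf9 := (None, None).
Definition g1 : gf9 := (Some false, None).

Definition gf9s : seq gf9 :=
  let T := [:: None; Some false; Some true] in [seq (s, t) | s <- T, t <- T].

Definition gvec : Type := gf9 * gf9 * gf9.

Definition gform (v w : gvec) : gf9 :=
  let: (x1, x2, x3) := v in let: (y1, y2, y3) := w in
  gadd (gadd (gmul x1 (gconj y1)) (gmul x2 (gconj y2))) (gmul x3 (gconj y3)).

(** One vector for each of the 91 points of the projective plane: its first non-zero coordinate is
    1. *)
Definition gnormalized : seq gvec :=
  [seq (g1, y, z) | y <- gf9s, z <- gf9s]
  ++ [seq (g0, g1, z) | z <- gf9s] ++ [:: (g0, g0, g1)].

Section PointTable.
Local Notation o := false (only parsing).
Local Notation i := true (only parsing).
Local Notation O := (None : trit) (only parsing).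
Local Notation P := (Some false : trit) (only parsing).
Local Notation M := (Some true : trit) (only parsing).

(* The row (u, v) makes {0, 1, u, u + 1} correspond to the line spanned by v. *)
Definition point_table : seq (boct * gvec) := [::
  (((o,o,o,i), (o,i,i,o)), ((P,O), (O,O), (P,P)));
  (((o,o,o,i), (o,i,i,i)), ((P,O), (O,O), (P,M)));
  (((o,o,o,i), (i,o,o,i)), ((P,O), (O,P), (P,O)));
  (((o,o,o,i), (i,o,i,i)), ((P,O), (M,O), (M,O)));
  (((o,o,o,i), (i,i,o,i)), ((P,O), (M,O), (P,O)));
  (((o,o,o,i), (i,i,i,o)), ((P,O), (O,M), (M,O)));
  (((o,o,i,i), (o,i,i,o)), ((P,O), (O,P), (O,M)));
  (((o,o,i,i), (o,i,i,i)), ((P,O), (O,M), (O,M)));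
  (((o,o,i,i), (i,o,o,i)), ((O,O), (P,O), (P,M)));
  (((o,o,i,i), (i,o,i,i)), ((P,O), (P,M), (O,O)));
  (((o,o,i,i), (i,i,o,i)), ((P,O), (M,M), (O,O)));
  (((o,o,i,i), (i,i,i,o)), ((O,O), (P,O), (P,P)));
  (((o,i,o,i), (o,i,i,o)), ((P,O), (O,O), (M,P)));
  (((o,i,o,i), (o,i,i,i)), ((P,O), (O,O), (M,M)));
  (((o,i,o,i), (i,o,o,i)), ((P,O), (O,M), (P,O)));
  (((o,i,o,i), (i,o,i,i)), ((P,O), (P,O), (M,O)));
  (((o,i,o,i), (i,i,o,i)), ((P,O), (P,O), (P,O)));
  (((o,i,o,i), (i,i,i,o)), ((P,O), (O,P), (M,O)));
  (((o,i,i,i), (o,o,o,o)), ((P,O), (O,M), (O,P)));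
  (((o,i,i,i), (o,o,o,i)), ((P,O), (O,P), (O,P)));
  (((o,i,i,i), (o,o,i,o)), ((P,O), (M,O), (O,P)));
  (((o,i,i,i), (o,o,i,i)), ((P,O), (P,O), (O,P)));
  (((o,i,i,i), (o,i,o,o)), ((P,O), (M,O), (O,M)));
  (((o,i,i,i), (o,i,o,i)), ((P,O), (P,O), (O,M)));
  (((o,i,i,i), (i,o,o,o)), ((O,O), (P,O), (M,P)));
  (((o,i,i,i), (i,o,i,o)), ((P,O), (M,P), (O,O)));
  (((o,i,i,i), (i,i,o,o)), ((P,O), (P,P), (O,O)));
  (((o,i,i,i), (i,i,i,i)), ((O,O), (P,O), (M,M))) ].

End PointTable.

(** A non-degenerate line of the plane is n^perp for a unique non-isotropic point n, so these
    normals index the blocks. *)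
Definition block_normals : seq gvec :=
  [seq n <- gnormalized | gform n n != g0].

Definition on_block (n : gvec) : seq (boct * gvec) :=
  [seq p <- point_table | gform p.2 n == g0].

(* The points on a block X = D + Dz are {0, 1, u + s, u + s + 1} with s in Dz,
   so the unit element and any three of them span X. *)
Definition block_gens (n : gvec) : seq boct :=
  bo1 :: [seq p.1 | p <- take 3 (on_block n)].

Definition nilpotents (u : boct) : seq boct :=
  [seq z <- bocts |
    [&& z != bo0, bomul z z == bo0
      & all (fun d => ~~ bopolar z d) (bospan [:: bo1; u])]].

Definition line_block (u z : boct) : seq boct :=
  let D := bospan [:: bo1; u] in [seq boadd d (bomul e z) | d <- D, e <- D].

Definition spans (s L : seq boct) : bool :=
  let S := bospan s in all (mem L) S && all (mem S) L.

Definition mul_closed (L : seq boct) : bool :=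
  all (fun x => all (fun y => bomul x y \in L) L) L.

(** * Finite checks on the tables *)

(** This is x^2 = tr(x) x - N(x) 1, solved for 1 when N(x) = 1. *)
Lemma bo1_square_check :
  all (fun x => bonorm x ==> (bo1 \in bospan [:: x; bomul x x])) bocts.
Proof. by vm_compute. Qed.

(** Since N(1 + x) = 1 + tr(x) + N(x), the premise says that x has norm and trace 1. Then {0, 1, x,
    x + 1} is a field of four elements, and the table stores one of its two generators. *)
Lemma bonorm_table_check :
  all (fun x => bonorm x && bonorm (boadd bo1 x) ==>
     has (fun p => (x == p.1) || (boadd bo1 x == p.1)) point_table) bocts.
Proof. by vm_compute. Qed.

Lemma point_table_field_check :
  all (fun p => let D := bospan [:: bo1; p.1] in
    [&& p.1 != bo0, bo1 \notin bospan [:: p.1], mul_closed D,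
        bopolar bo1 p.1 & all (fun x => bonorm x || (x == bo0)) D]) point_table.
Proof. by vm_compute. Qed.

Lemma point_table_isotropic_check :
  all (fun p => (p.2 \in gnormalized) && (gform p.2 p.2 == g0)) point_table.
Proof. by vm_compute. Qed.

Lemma isotropic_table_check :
  all (fun v => (gform v v == g0) ==> (v \in [seq p.2 | p <- point_table]))
    gnormalized.
Proof. by vm_compute. Qed.

(** Serves the injectivity of both parametrizations of points: distinct isotropic lines are never
    orthogonal, and distinct rows give distinct fields. *)
Lemma point_table_inj_check :
  all (fun p => all (fun q =>
    (gform p.2 q.2 == g0) || (p.1 \in bospan [:: bo1; q.1]) ==> (p == q))
    point_table) point_table.
Proof. by vm_compute. Qed.

(** Two blocks with all points of one on the other coincide, so a block is determined by its points
    on either side. *)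
Lemma block_inj_check :
  all (fun n => let s := on_block n in
    all (fun m => all (fun p => gform p.2 m == g0) s ==> (m == n)) block_normals)
    block_normals.
Proof. by vm_compute. Qed.

(** The equality matches the two incidences; the second conjunct makes the inclusion of D in X
    strict. *)
Lemma incidence_check :
  all (fun n => let X := bospan (block_gens n) in
    all (fun p => ((p.1 \in X) == (gform p.2 n == g0))
          && ~~ all (mem (bospan [:: bo1; p.1])) X)
      point_table) block_normals.
Proof. by vm_compute. Qed.

(** Every D + Dz is a tabulated block. Since D lies on it, only normals orthogonal to the vector of
    D have to be tried. *)
Lemma line_block_check :
  all (fun p => let B := [seq n <- block_normals | gform p.2 n == g0] in
    all (fun z => let L := line_block p.1 z in
      has (fun n => spans (block_gens n) L) B) (nilpotents p.1)) point_table.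
Proof. by vm_compute. Qed.

(** Conversely, a single D on the block and a single z witness that its span has the form D + Dz. *)
Lemma block_line_check :
  all (fun n => mul_closed (bospan (block_gens n)) &&
    has (fun p => has (fun z => spans (block_gens n) (line_block p.1 z))
                    (nilpotents p.1)) (take 1 (on_block n)))
    block_normals.
Proof. by vm_compute. Qed.

(* Otherwise unification unfolds them when it compares memberships. *)
Opaque point_table block_normals bocts.

(** The isomorphism goes back along the parametrization of [S] and then forward along that of [T].
    The index types are pointed because the total inverse [pinv] needs a default value. *)
Lemma isomorphic_param (S T : incidence_structure) (A B : pointedType)
    (sA : set A) (sB : set B) pS pT bS bT :
    set_bij sA (points S) pS -> set_bij sA (points T) pT ->
    set_bij sB (blocks S) bS -> set_bij sB (blocks T) bT ->
    (forall a b, sA a -> sB b ->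
       incident (pS a) (bS b) <-> incident (pT a) (bT b)) ->
  isomorphic S T.
Proof.
move=> pSbij pTbij bSbij bTbij incST.
exists (pT \o pinv sA pS), (bT \o pinv sB bS); split.
- exact: set_bij_comp (bijpinv_bij _ pSbij) pTbij.
- exact: set_bij_comp (bijpinv_bij _ bSbij) bTbij.
move=> _ _ /(set_bij_surj pSbij)[a Aa <-] /(set_bij_surj bSbij)[b Bb <-] /=.
by rewrite !pinvKV ?inE ?incST //; [case: bSbij | case: pSbij].
Qed.

(** * Points and blocks in the octonions *)

Definition bit (x : 'F_2) : bool := x != 0.

Lemma F2P (x : 'F_2) : x = 0 \/ x = 1.
Proof. by case: x => [[|[|//]] x2]; [left | right]; apply: val_inj. Qed.

Lemma natr_bit (x : 'F_2) : (bit x)%:R = x.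
Proof. by case: (F2P x) => ->. Qed.

Lemma bit_natr (b : bool) : bit b%:R = b.
Proof. by case: b. Qed.

Lemma bitD x y : bit (x + y) = bit x (+) bit y.
Proof. by case: (F2P x) => ->; case: (F2P y) => ->. Qed.

Lemma bitN x : bit (- x) = bit x.
Proof. by case: (F2P x) => ->. Qed.

Lemma bitM x y : bit (x * y) = bit x && bit y.
Proof. by case: (F2P x) => ->; case: (F2P y) => ->. Qed.

Definition quat_bits (a : 'M['F_2]_2) : bquat :=
  (bit (a 0 0), bit (a 0 1), bit (a 1 0), bit (a 1 1)).

Definition bits_quat (q : bquat) : 'M['F_2]_2 :=
  let: (a, b, c, d) := q in
  \matrix_(i, j) (if i == 0 then if j == 0 then a else b
                  else if j == 0 then c else d)%:R.

Lemma quat_bitsK : cancel quat_bits bits_quat.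
Proof.
move=> a; apply/matrixP => i j; rewrite mxE.
by case: i => [[|[|//]] ?]; case: j => [[|[|//]] ?];
  rewrite -[RHS]natr_bit; congr (bit (a _ _))%:R; apply: val_inj.
Qed.

Lemma bits_quatK : cancel bits_quat quat_bits.
Proof. by case=> [[[a b] c] d]; rewrite /quat_bits !mxE !bit_natr. Qed.

Lemma quat_bitsD a b : quat_bits (a + b) = bqadd (quat_bits a) (quat_bits b).
Proof. by rewrite /quat_bits /= !mxE !bitD. Qed.

Lemma quat_bitsM a b : quat_bits (a *m b) = bqmul (quat_bits a) (quat_bits b).
Proof.
rewrite /quat_bits /= !mxE !big_ord_recl !big_ord0 !addr0 !bitD !bitM.
by rewrite (_ : lift _ _ = 1) //; apply: val_inj.
Qed.

Lemma quat_bits_conj a : quat_bits (quatconj a) = bqconj (quat_bits a).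
Proof.
rewrite /quat_bits /quatconj /= !mxE /mxtrace !big_ord_recl big_ord0 /= addr0.
rewrite (_ : lift _ _ = 1); last exact: val_inj.
rewrite !mulr1n !mulr0n !bitD !bitN.
have -> : bit 0 = false by [].
by case: (bit (a 0 0)); case: (bit (a 1 1)).
Qed.

Lemma bit_det a : bit (\det a) = bqdet (quat_bits a).
Proof.
rewrite (expand_det_row _ 0) !big_ord_recl big_ord0 addr0.
rewrite /cofactor !det_mx11 !mxE /= expr0 expr1 mul1r mulN1r mulrN.
rewrite bitD bitN !bitM.
congr (bit (a _ _) && bit (a _ _) (+) bit (a _ _) && bit (a _ _));
  exact: val_inj.
Qed.

Definition oct_bits (u : octonion 'F_2) : boct :=
  (quat_bits u.1, quat_bits u.2).
Definition bits_oct (x : boct) : octonion 'F_2 :=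
  (bits_quat x.1, bits_quat x.2).

Lemma oct_bitsK : cancel oct_bits bits_oct.
Proof. by case=> a b; rewrite /bits_oct !quat_bitsK. Qed.

Lemma bits_octK : cancel bits_oct oct_bits.
Proof. by case=> a b; rewrite /oct_bits !bits_quatK. Qed.

Lemma oct_bitsD u v : oct_bits (u + v) = boadd (oct_bits u) (oct_bits v).
Proof. by rewrite /oct_bits /= !quat_bitsD. Qed.

Lemma oct_bitsM u v : oct_bits (octmul u v) = bomul (oct_bits u) (oct_bits v).
Proof. by rewrite /oct_bits !(quat_bits_conj, quat_bitsD, quat_bitsM). Qed.

Lemma bit_octnorm u : bit (octnorm u) = bonorm (oct_bits u).
Proof. by rewrite bitD bitN !bit_det. Qed.

Lemma bit_octpolar u v : bit (octpolar u v) = bopolar (oct_bits u) (oct_bits v).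
Proof. by rewrite /octpolar 2!bitD !bitN !bit_octnorm oct_bitsD. Qed.

Lemma oct_bits0 : oct_bits 0 = bo0.
Proof. by rewrite /oct_bits /quat_bits !mxE. Qed.

Lemma mem_bocts x : x \in bocts.
Proof. by case: x => -[[[[] []] []] []] [[[[] []] []] []]. Qed.

Definition octspan (s : seq boct) : {vspace octonion 'F_2} :=
  <<map bits_oct s>>%VS.

(** Coefficients in F_2 are 0 or 1, so a span is a set of subset sums. This turns membership in a
    subspace into list membership, where the checks apply. *)
Lemma mem_octspan s u : (u \in octspan s) = (oct_bits u \in bospan s).
Proof.
elim: s u => [|x s IHs] u.
  by rewrite /octspan span_nil memv0 mem_seq1 -oct_bits0 (can_eq oct_bitsK).
rewrite /octspan /= span_cons mem_cat; apply/memv_addP/orP => [[v]|].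
  move=> /vlineP[a ->] [w]; rewrite -/(octspan s) IHs => ws ->.
  case: (F2P a) => ->; rewrite ?scale0r ?add0r ?scale1r; [by left | right].
  by rewrite oct_bitsD bits_octK map_f.
case=> [us | /mapP[y ys u_xy]].
  by exists 0; rewrite ?mem0v //; exists u; rewrite ?add0r // -/(octspan s) IHs.
exists (bits_oct x); rewrite ?memv_line //; exists (bits_oct y).
  by rewrite -/(octspan s) IHs bits_octK.
by apply: (can_inj oct_bitsK); rewrite oct_bitsD !bits_octK.
Qed.

Lemma sub_octspan s (V : {vspace octonion 'F_2}) :
  {in s, forall x, bits_oct x \in V} -> (octspan s <= V)%VS.
Proof.
by move=> sV; apply/span_subvP => _ /mapP[x xs ->]; apply: sV.
Qed.

Lemma mem_octspan_gen s x : x \in s -> bits_oct x \in octspan s.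
Proof. by move=> xs; apply/memv_span/map_f. Qed.

Lemma octpolar0P u v :
  octpolar u v = 0 <-> ~~ bopolar (oct_bits u) (oct_bits v).
Proof. by rewrite -bit_octpolar negbK; split=> [->|/eqP]. Qed.

Lemma octnorm0P u : octnorm u = 0 <-> ~~ bonorm (oct_bits u).
Proof. by rewrite -bit_octnorm negbK; split=> [->|/eqP]. Qed.

Lemma bomul_in_octspan s u v : mul_closed (bospan s) ->
  u \in octspan s -> v \in octspan s -> octmul u v \in octspan s.
Proof.
rewrite !mem_octspan oct_bitsM => sM us vs.
by move/allP: sM => /(_ _ us)/allP/(_ _ vs).
Qed.

Lemma octD_octspan p : p \in point_table -> octD (octspan [:: bo1; p.1]).
Proof.
move=> /(allP point_table_field_check)/and5P[p0 p1 pM p1N pN]; split.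
- by move=> u v; apply: bomul_in_octspan.
- have: free [:: bits_oct bo1; bits_oct p.1].
    rewrite free_cons -[span _]/(octspan [:: p.1]) mem_octspan bits_octK p1.
    rewrite seq1_free; apply: contraNneq p0 => p0.
    by rewrite -[p.1]bits_octK p0 oct_bits0.
  by move/eqP.
- move=> u; rewrite mem_octspan => /(allP pN)/orP[uN /octnorm0P|/eqP u0 _].
    by rewrite uN.
  by apply: (can_inj oct_bitsK); rewrite oct_bits0.
- exists (bits_oct bo1), (bits_oct p.1).
  rewrite !mem_octspan_gen ?inE ?eqxx ?orbT //; split=> //.
  by apply/eqP => /octpolar0P; rewrite !bits_octK p1N.
Qed.

(** By anisotropy all non-zero elements of D have norm 1. Hence 1 lies in D, and any v in D outside
    F_2 satisfies N(v) = N(1 + v) = 1, which places v or 1 + v in the table. *)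
Lemma octDP D : octD D ->
  exists2 p, p \in point_table & D = octspan [:: bo1; p.1].
Proof.
case=> DM dimD DN _.
have bonormD u : u \in D -> u != 0 -> bonorm (oct_bits u).
  by move=> Du; apply: contraNT => /octnorm0P /DN ->.
have one_D : bits_oct bo1 \in D.
  have D0 : D != 0%VS by rewrite -dimv_eq0 dimD.
  have D_u := memv_pick D; set u := vpick D in D_u.
  have /bonormD uN := D_u; rewrite vpick0 in uN; have {}uN := uN D0.
  have: bits_oct bo1 \in octspan [:: oct_bits u; oct_bits (octmul u u)].
    rewrite mem_octspan bits_octK oct_bitsM.
    exact: (implyP (allP bo1_square_check _ (mem_bocts _))).
  apply/subvP/sub_octspan => x; rewrite !inE.
  case/orP=> /eqP->; rewrite oct_bitsK //.
  exact: DM.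
(* Stated for any such v because the table may contain 1 + v in place of the chosen one. *)
have octspanD v : v \in D -> v \notin <[bits_oct bo1]>%VS ->
    D = octspan [:: bo1; oct_bits v].
  move=> Dv v1; apply/esym/eqP; rewrite eqEdim dimD; apply/andP; split.
    apply: sub_octspan => x; rewrite !inE.
    by case/orP=> /eqP-> //; rewrite oct_bitsK.
  have /eqP dim_v1 : free [:: v; bits_oct bo1].
    rewrite free_cons span_seq1 v1 seq1_free.
    by apply/eqP => /(congr1 oct_bits); rewrite bits_octK oct_bits0.
  apply: (@leq_trans (\dim <<[:: v; bits_oct bo1]>>)); first by rewrite dim_v1.
  apply: dimvS; apply/span_subvP => w.
  by rewrite !inE => /orP[]/eqP->; rewrite ?mem_octspan_gen ?inE ?eqxx //
    -[v in v \in _]oct_bitsK mem_octspan_gen ?inE ?eqxx ?orbT.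
have [v Dv v1] : exists2 v, v \in D & v \notin <[bits_oct bo1]>%VS.
  apply/subvPn; apply/negP => /dimvS; rewrite dimD dim_vline.
  by case: (_ != 0).
have v0 w : w \notin <[bits_oct bo1]>%VS -> w != 0.
  by apply: contraNneq => ->; rewrite mem0v.
have Dv1 : bits_oct bo1 + v \in D by rewrite memvD.
have v11 : bits_oct bo1 + v \notin <[bits_oct bo1]>%VS.
  by rewrite rpredDl ?memv_line.
have /implyP := allP bonorm_table_check (oct_bits v) (mem_bocts _).
rewrite -[bo1 in boadd bo1 _]bits_octK -oct_bitsD !bonormD ?v0 //.
move=> /(_ isT)/hasP[p p_tab /orP v_p]; exists p; first exact: p_tab.
by case: v_p => /eqP <-; apply: octspanD.
Qed.

Lemma mem_line_block u z w :
  reflect (exists d e, [/\ d \in octspan [:: bo1; u], e \in octspan [:: bo1; u]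
                        & w = d + octmul e z])
          (oct_bits w \in line_block u (oct_bits z)).
Proof.
apply: (iffP allpairsP) => [[[x y] /= [xD yD w_xy]]|[d [e [dD eD ->]]]].
  exists (bits_oct x), (bits_oct y).
  rewrite !mem_octspan !bits_octK; split=> //.
  by apply: (can_inj oct_bitsK); rewrite oct_bitsD oct_bitsM !bits_octK.
exists (oct_bits d, oct_bits e).
by rewrite -!mem_octspan oct_bitsD oct_bitsM.
Qed.

(** Converts a successful list comparison into the description of X = D + Dz used by [octX], in both
    directions. *)
Lemma spans_line_block n u z (X : {vspace octonion 'F_2}) :
    spans (block_gens n) (line_block u (oct_bits z)) ->
    (forall w, w \in X <->
      exists d e, [/\ d \in octspan [:: bo1; u], e \in octspan [:: bo1; u]
                   & w = d + octmul e z]) <->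
  X = octspan (block_gens n).
Proof.
case/andP=> /allP sL /allP Ls.
have sL_P w : w \in octspan (block_gens n) <->
    exists d e, [/\ d \in octspan [:: bo1; u], e \in octspan [:: bo1; u]
                 & w = d + octmul e z].
  rewrite mem_octspan; split=> [/sL/mem_line_block //|].
  by move/mem_line_block/Ls.
split=> [X_P | -> //]; apply/vspaceP => w.
by apply/idP/idP => [/X_P/sL_P | /sL_P/X_P].
Qed.

Lemma octXP X : octX X ->
  exists2 n, n \in block_normals & X = octspan (block_gens n).
Proof.
case=> _ [_ [z [/octDP[p p_tab ->] z_orth z_sq z0 X_P]]].
have z_nil : oct_bits z \in nilpotents p.1.
  rewrite mem_filter mem_bocts andbT; apply/and3P; split.
  - by rewrite -oct_bits0 (can_eq oct_bitsK).
  - by rewrite -oct_bitsM z_sq oct_bits0.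
  apply/allP => d; rewrite -[d]bits_octK -mem_octspan => d_D.
  exact/octpolar0P/z_orth.
have /allP/(_ _ z_nil)/hasP[n] := allP line_block_check _ p_tab.
rewrite mem_filter => /andP[_ n_bl] nL; exists n => //.
exact/(spans_line_block X nL).
Qed.

Lemma octX_octspan n : n \in block_normals -> octX (octspan (block_gens n)).
Proof.
move=> /(allP block_line_check)/andP[nM /hasP[p /mem_take]].
rewrite mem_filter => /andP[_ p_tab] /hasP[b].
rewrite mem_filter => /andP[/and3P[b0 bM /allP bD] _].
rewrite -[b]bits_octK => nL; split=> [u v|]; first exact: bomul_in_octspan.
exists (octspan [:: bo1; p.1]), (bits_oct b); split.
- exact: octD_octspan.
- move=> d; rewrite mem_octspan => /bD b_d.
  by apply/octpolar0P; rewrite bits_octK.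
- by apply: (can_inj oct_bitsK); rewrite oct_bitsM bits_octK oct_bits0 (eqP bM).
- by apply: contraNneq b0 => b0; rewrite -[b]bits_octK b0 oct_bits0.
exact/(spans_line_block _ nL).
Qed.

Lemma incident_octU p n : p \in point_table -> n \in block_normals ->
  incident (i := octU 'F_2) (octspan [:: bo1; p.1]) (octspan (block_gens n))
  <-> gform p.2 n = g0.
Proof.
move=> p_tab n_bl.
have /allP/(_ p p_tab)/andP[/eqP pn pn'] := allP incidence_check n n_bl.
rewrite /=; split=> [/andP[/subvP/(_ (bits_oct p.1))]|/eqP pn0].
  rewrite mem_octspan_gen ?inE ?eqxx ?orbT // mem_octspan bits_octK pn.
  by move=> /(_ isT)/eqP.
rewrite -{}pn in pn0; apply/andP; split.
  apply: sub_octspan => x; rewrite !inE => /orP[]/eqP->.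
    by rewrite mem_octspan_gen ?inE ?eqxx.
  by rewrite mem_octspan bits_octK.
(* If D were equal to X, all of X would lie in D, against the second half of the check. *)
apply: contraNneq pn' => eqDX; apply/allP => x.
by rewrite -[x]bits_octK -mem_octspan -eqDX mem_octspan.
Qed.

Lemma octD_bij :
  set_bij [set` point_table]%classic (@octD 'F_2)
    (fun p => octspan [:: bo1; p.1]).
Proof.
split=> [p|p q|D /octDP[p p_tab ->]]; [exact: octD_octspan| |by exists p].
rewrite !inE => p_tab q_tab pq.
have /allP/(_ _ q_tab)/implyP := allP point_table_inj_check _ p_tab.
move=> pq_inj; apply/eqP/pq_inj; apply/orP; right.
by rewrite -[p.1]bits_octK -mem_octspan -pq mem_octspan_gen ?inE ?eqxx ?orbT.
Qed.

Lemma octX_bij :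
  set_bij [set` block_normals]%classic (@octX 'F_2)
    (fun n => octspan (block_gens n)).
Proof.
split=> [n|n m|X /octXP[n n_bl ->]]; [exact: octX_octspan| |by exists n].
rewrite !inE => n_bl m_bl nm.
have /allP/(_ _ m_bl)/implyP := allP block_inj_check _ n_bl.
(* Equal subspaces are incident with the same points, so each point on [n] is on [m]. *)
move=> nm_inj; apply/esym/eqP/nm_inj/allP => p.
rewrite mem_filter => /andP[/eqP pn p_tab]; apply/eqP.
by apply/incident_octU => //; rewrite -nm; apply/incident_octU.
Qed.

(** * Points and blocks in the Hermitian plane *)

Section HermitianPlane.
Variables (K : fieldType) (i : K).
Hypotheses (K_char3 : 1 + 1 + 1 = 0 :> K) (i_sqr : i * i = -1).

Definition trit_val (t : trit) : K := if t is Some b then (-1) ^+ b else 0.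

Definition gf9_val (x : gf9) : K := trit_val x.1 + trit_val x.2 * i.

Lemma addrr1 : 1 + 1 = -1 :> K.
Proof. by apply/eqP; rewrite -addr_eq0 K_char3. Qed.

Lemma trit_valD s t : trit_val (tadd s t) = trit_val s + trit_val t.
Proof.
case: s t => [[]|] [[]|] /=; rewrite ?expr0 ?expr1 ?addr0 ?add0r ?addNr ?subrr //.
all: by rewrite -?opprD addrr1 ?opprK.
Qed.

Lemma trit_valN t : trit_val (topp t) = - trit_val t.
Proof. by case: t => [[]|] /=; rewrite ?expr0 ?expr1 ?opprK ?oppr0. Qed.

Lemma trit_valM s t : trit_val (tmul s t) = trit_val s * trit_val t.
Proof.
by case: s t => [a|] [b|]; rewrite /= ?mul0r ?mulr0 // signr_addb.
Qed.

Lemma gf9_valD x y : gf9_val (gadd x y) = gf9_val x + gf9_val y.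
Proof. by rewrite /gf9_val !trit_valD mulrDl addrACA. Qed.

Lemma gf9_valM x y : gf9_val (gmul x y) = gf9_val x * gf9_val y.
Proof.
rewrite /gf9_val /= !(trit_valD, trit_valN, trit_valM) !mulrDl !mulrDr.
rewrite -mulrN1 -i_sqr.
rewrite !mulrA !(mulrAC _ i) -!addrA; congr (_ + _); rewrite addrC -addrA.
by congr (_ + _).
Qed.

Lemma gf9_val0 : gf9_val g0 = 0.
Proof. by rewrite /gf9_val /= mul0r addr0. Qed.

Lemma gf9_val1 : gf9_val g1 = 1.
Proof. by rewrite /gf9_val /= mul0r addr0. Qed.

Lemma mem_gf9s x : x \in gf9s.
Proof. by case: x => [[[]|] [[]|]]. Qed.

Lemma gf9_inv_check :
  all (fun x => (x == g0) || has (fun y => gmul x y == g1) gf9s) gf9s.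
Proof. by vm_compute. Qed.

(** A non-zero code has an inverse in the model, and the multiplicative [gf9_val] carries it to an
    inverse in [K]. *)
Lemma gf9_val_eq0 x : (gf9_val x == 0) = (x == g0).
Proof.
apply/eqP/eqP => [x0 | ->]; last exact: gf9_val0.
have /orP[/eqP //|/hasP[y _ /eqP/(congr1 gf9_val)/eqP]] :=
  allP gf9_inv_check x (mem_gf9s x).
by rewrite gf9_valM x0 mul0r gf9_val1 eq_sym oner_eq0.
Qed.

Variable theta : {rmorphism K -> K}.
Hypothesis theta_i : theta i = - i.

Lemma theta_gf9_val x : theta (gf9_val x) = gf9_val (gconj x).
Proof.
have theta_t t : theta (trit_val t) = trit_val t.
  by case: t => [b|]; rewrite /= ?rmorph0 // rmorph_sign.
by rewrite rmorphD rmorphM !theta_t theta_i /gf9_val /= trit_valN mulNr mulrN.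
Qed.

Hypothesis gf9_val_surj : forall a, exists x, a = gf9_val x.

Lemma theta_fixed a : theta a = a -> [\/ a = 0, a = 1 | a = -1].
Proof.
have gf9_valN1 : gf9_val (Some true, None) = -1.
  by rewrite /gf9_val /= mul0r addr0.
case: (gf9_val_surj a) => x -> /eqP; rewrite theta_gf9_val -subr_eq0.
(* The difference of theta a and a is written as the value of a code, so that its vanishing is
   decided on the nine codes. *)
rewrite -[- gf9_val x]mulN1r -gf9_valN1.
rewrite -gf9_valM -gf9_valD gf9_val_eq0 -gf9_val1 -gf9_val0.
case: x => [[[]|] [[]|]] // _; by [constructor 1 | constructor 2 | constructor 3].
Qed.

Variable h : {hermitian_sym 'rV[K]_3 for theta}.

Lemma formC u v : h u v = theta (h v u).
Proof. by rewrite hermC expr0 mul1r. Qed.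

Lemma formDl u v w : h (u + v) w = h u w + h v w.
Proof. by rewrite linearDl. Qed.

Lemma formDr u v w : h u (v + w) = h u v + h u w.
Proof. by rewrite linearDr. Qed.

Lemma formZl a u v : h (a *: u) v = a * h u v.
Proof. by rewrite linearZl_LR. Qed.

Lemma formZr a u v : h u (a *: v) = theta a * h u v.
Proof. by rewrite linearZr_LR. Qed.

Implicit Types (W : {vspace 'rV[K]_3}).

(** * Orthonormal bases of Hermitian spaces *)

Definition nondeg_on W := {in W, forall w, {in W, forall v, h w v = 0} -> w = 0}.

(** Polarization shows that a + theta a = 0 for a = h u v, and likewise for h u (i v) = - i a. The
    two relations give 2 i a = 0, hence a = 0. *)
Lemma isotropic_form0 W :
  {in W, forall w, h w w = 0} -> {in W &, forall u v, h u v = 0}.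
Proof.
move=> W0 u v uW vW.
have polar w : w \in W -> h u w + theta (h u w) = 0.
  move=> wW; have := W0 _ (memvD uW wW).
  by rewrite formDl !formDr !W0 // add0r addr0 [h w u]formC.
have h_eq : theta (h u v) = - h u v.
  by apply/eqP; rewrite -addr_eq0 addrC polar.
have := polar _ (memvZ i vW).
rewrite formZr theta_i rmorphM rmorphN theta_i opprK h_eq mulrN mulNr.
rewrite -opprD -mulrDr => /eqP; rewrite oppr_eq0 mulf_eq0 => /orP[i0|].
  by move: i_sqr; rewrite (eqP i0) mul0r => /eqP; rewrite eq_sym oppr_eq0 oner_eq0.
rewrite -{1 2}[h u v]mul1r -mulrDl mulf_eq0 => /orP[|/eqP //].
by rewrite addrr1 oppr_eq0 oner_eq0.
Qed.

Lemma unit_vector W : nondeg_on W -> W != 0%VS ->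
  exists2 e, e \in W & h e e = 1.
Proof.
move=> Wnd W0.
have [w wW hw0] : exists2 w, w \in W & h w w != 0.
  (* If all of [W] were isotropic, the form would vanish on it and [W] would be its own radical. *)
  apply: contrapT => W_iso; case/eqP: W0; apply/eqP; rewrite -vpick0; apply/eqP.
  apply: Wnd (memv_pick W) _ => v; apply: isotropic_form0 (memv_pick W) => w wW.
  by apply/eqP; apply: contrapT => /negP hw; case: W_iso; exists w.
have [hw_0|hw1|hwN1] := theta_fixed (esym (formC w w)).
- by rewrite hw_0 eqxx in hw0.
- by exists w.
(* The norm of 1 + i is (1 + i)(1 - i) = 2 = -1, which corrects h w w = -1 to 1. *)
exists ((1 + i) *: w); first exact: memvZ.
rewrite formZl formZr hwN1 rmorphD rmorph1 theta_i mulrN1 mulrN.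
rewrite mulrBr mulr1 mulrDl mul1r i_sqr opprB.
by rewrite opprD [- 1 - i]addrC addrACA subrr add0r -opprD addrr1 opprK.
Qed.

Lemma nondeg_on_full : nondegenerate h -> nondeg_on fullv.
Proof.
move=> /eqP h_nd w _ w0; apply/eqP; rewrite -memv0 -h_nd.
by apply/mem_orthovP.
Qed.

Lemma mem_perp W e v : h e e != 0 -> e \in W -> v \in W ->
  v - (h v e / h e e) *: e \in (W :&: orthov h <[e]>)%VS.
Proof.
move=> e0 eW vW; rewrite memv_cap memvB ?memvZ //= mem_orthov1.
by rewrite -scaleNr formDl formZl mulNr divfK // subrr.
Qed.

Lemma nondeg_on_perp W e : h e e != 0 -> e \in W ->
  nondeg_on W -> nondeg_on (W :&: orthov h <[e]>).
Proof.
move=> e0 eW Wnd w; rewrite memv_cap mem_orthov1 => /andP[wW /eqP we] w0.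
apply: Wnd => // v vW.
rewrite -[v](subrK ((h v e / h e e) *: e)) formDr formZr we mulr0 addr0.
exact/w0/mem_perp.
Qed.

Lemma dim_perp W e : h e e != 0 -> e \in W ->
  \dim (W :&: orthov h <[e]>) = (\dim W).-1.
Proof.
move=> e0 eW; apply/esym/eq_dim_orthov1.
by apply/mem_orthovPn; exists e.
Qed.

(** One Gram-Schmidt step, with everything needed to repeat it on the complement of e in [W]. *)
Lemma split_unit W : nondeg_on W -> W != 0%VS ->
  exists e, [/\ e \in W, h e e = 1, nondeg_on (W :&: orthov h <[e]>),
    \dim (W :&: orthov h <[e]>) = (\dim W).-1 &
    {in W, forall v, v - h v e *: e \in (W :&: orthov h <[e]>)%VS}].
Proof.
move=> Wnd /(unit_vector Wnd)[e eW e1].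
have e0 : h e e != 0 by rewrite e1 oner_eq0.
exists e; split=> //; first exact: nondeg_on_perp.
  exact: dim_perp.
by move=> v /(mem_perp e0 eW); rewrite e1 divr1.
Qed.

Lemma orthonormal_basis : nondegenerate h ->
  exists e1 e2 e3,
    [/\ [/\ h e1 e1 = 1, h e2 e2 = 1 & h e3 e3 = 1],
        [/\ h e1 e2 = 0, h e1 e3 = 0 & h e2 e3 = 0]
      & forall v, v = h v e1 *: e1 + h v e2 *: e2 + h v e3 *: e3].
Proof.
move=> h_nd; have nd0 := nondeg_on_full h_nd.
have dim0 : \dim {:'rV[K]_3} = 3%N by rewrite dimvf dim_matrix.
have dim_n0 W n : \dim W = n.+1 -> W != 0%VS by rewrite -dimv_eq0 => ->.
have [e1 [_ h11 nd1 dim1 P1]] := split_unit nd0 (dim_n0 _ _ dim0).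
rewrite dim0 in dim1.
have [e2 [e2W h22 nd2 dim2 P2]] := split_unit nd1 (dim_n0 _ _ dim1).
rewrite dim1 in dim2.
have [e3 [e3W h33 nd3 dim3 P3]] := split_unit nd2 (dim_n0 _ _ dim2).
move: e3W e2W; rewrite !memv_cap !mem_orthov1.
move=> /andP[/andP[_ /eqP h31] /eqP h32] /andP[_ /eqP h21].
have h0C u v : h u v = 0 -> h v u = 0 by move=> huv; rewrite formC huv rmorph0.
have [[h12 h13] h23] := (h0C _ _ h21, h0C _ _ h31, h0C _ _ h32).
exists e1, e2, e3; split=> // v.
have /eqP := dim3; rewrite dim2 dimv_eq0 => /eqP W0.
(* After three projections the remainder of v lies in a space of dimension 0; this is the expansion
   of v. *)
have /P2/P3 := P1 v (memvf v).
rewrite W0 memv0 -!scaleNr !formDl !formZl h12 h13 h23.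
rewrite !mulr0 !addr0 !scaleNr -!addrA -!opprD subr_eq0 => /eqP {1}->.
by rewrite addrA.
Qed.

(** * Coordinates with respect to an orthonormal basis *)

Variables e1 e2 e3 : 'rV[K]_3.
Hypothesis e_unit : [/\ h e1 e1 = 1, h e2 e2 = 1 & h e3 e3 = 1].
Hypothesis e_orth : [/\ h e1 e2 = 0, h e1 e3 = 0 & h e2 e3 = 0].
Hypothesis e_basis : forall v, v = h v e1 *: e1 + h v e2 *: e2 + h v e3 *: e3.

Definition gvect (x : gvec) : 'rV[K]_3 :=
  gf9_val x.1.1 *: e1 + gf9_val x.1.2 *: e2 + gf9_val x.2 *: e3.

Lemma form_gvect x y : h (gvect x) (gvect y) = gf9_val (gform x y).
Proof.
case: e_unit e_orth => h11 h22 h33 [h12 h13 h23].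
have [h21 h31 h32] : [/\ h e2 e1 = 0, h e3 e1 = 0 & h e3 e2 = 0].
  by rewrite formC h12 [h e3 e1]formC h13 [h e3 e2]formC h23 rmorph0.
case: x y => [[x1 x2] x3] [[y1 y2] y3].
rewrite /gvect /= !formDl !formDr !formZl !formZr.
rewrite h11 h22 h33 h12 h13 h23 h21 h31 h32.
by rewrite !mulr0 !mulr1 !addr0 !add0r !theta_gf9_val !gf9_valD !gf9_valM.
Qed.

Lemma form_gvect_eq0 x y : (h (gvect x) (gvect y) == 0) = (gform x y == g0).
Proof. by rewrite form_gvect gf9_val_eq0. Qed.

(** Non-degeneracy in coordinates: a vector that pairs non-trivially with another one is not
    zero. *)
Lemma gnormalized_check :
  all (fun x => has (fun y => gform x y != g0) gnormalized) gnormalized.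
Proof. by vm_compute. Qed.

Lemma gvect_neq0 x : x \in gnormalized -> gvect x != 0.
Proof.
move=> /(allP gnormalized_check)/hasP[y _].
by apply: contraNneq => x0; rewrite -form_gvect_eq0 x0 linear0l.
Qed.

(** The scalar c is the first non-zero coordinate of v; the remaining coordinates divided by c have
    codes because [gf9_val] is surjective. *)
Lemma gnormalizedP v : v != 0 ->
  exists2 c, c != 0 & exists2 x, x \in gnormalized & v = c *: gvect x.
Proof.
have gf9_val_div a b : b != 0 -> exists x, a = b * gf9_val x.
  move=> b0; have [x xE] := gf9_val_surj (b^-1 * a).
  by exists x; rewrite -xE mulVKf.
have scale c x1 x2 x3 : c *: gvect (x1, x2, x3) =
    (c * gf9_val x1) *: e1 + (c * gf9_val x2) *: e2 + (c * gf9_val x3) *: e3.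
  by rewrite /gvect !scalerDr !scalerA.
move=> v0; rewrite [v]e_basis.
have [h1|h1] := eqVneq (h v e1) 0; last first.
  have [x2 ->] := gf9_val_div (h v e2) _ h1.
  have [x3 ->] := gf9_val_div (h v e3) _ h1.
  exists (h v e1) => //; exists (g1, x2, x3).
    by rewrite mem_cat (allpairs_f (fun y z => (g1, y, z))) ?mem_gf9s.
  by rewrite scale gf9_val1 mulr1.
have [h2|h2] := eqVneq (h v e2) 0; last first.
  have [x3 ->] := gf9_val_div (h v e3) _ h2.
  exists (h v e2) => //; exists (g0, g1, x3).
    by rewrite !mem_cat (map_f (fun z => (g0, g1, z))) ?mem_gf9s ?orbT.
  by rewrite scale gf9_val1 gf9_val0 mulr1 mulr0 h1.
exists (h v e3).
  by apply: contraNneq v0 => h3; rewrite [v]e_basis h1 h2 h3 !scale0r !addr0.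
exists (g0, g0, g1); first by rewrite !mem_cat mem_seq1 eqxx !orbT.
by rewrite scale gf9_val1 gf9_val0 mulr1 !mulr0 h1 h2.
Qed.

Definition herm_point (p : boct * gvec) : {vspace 'rV[K]_3} := <[gvect p.2]>%VS.

Definition herm_block (n : gvec) : set {vspace 'rV[K]_3} :=
  [set P | hermitian_points h P /\ (P <= orthov h <[gvect n]>)%VS]%classic.

Lemma line_gvect c x : c != 0 -> <[c *: gvect x]>%VS = <[gvect x]>%VS.
Proof.
move=> c0; apply/eqP; rewrite eqEsubv -!memvE memvZ ?memv_line //=.
by apply/vlineP; exists c^-1; rewrite scalerA mulVf ?scale1r.
Qed.

Lemma herm_point_bij :
  set_bij [set` point_table]%classic (hermitian_points h) herm_point.
Proof.
split.
- move=> p /(allP point_table_isotropic_check)/andP[p_norm p_iso].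
  split; first by rewrite dim_vline gvect_neq0.
  move=> _ _ /vlineP[a ->] /vlineP[b ->]; rewrite formZl formZr.
  by move: p_iso; rewrite -form_gvect_eq0 => /eqP->; rewrite !mulr0.
- move=> p q; rewrite !inE => p_tab q_tab pq.
  have /allP/(_ _ q_tab)/implyP := allP point_table_inj_check _ p_tab.
  move=> pq_inj; apply/eqP/pq_inj; rewrite -form_gvect_eq0.
  (* If the lines are equal, the first vector is a multiple of the second, isotropic one and so is
     orthogonal to it. *)
  have : gvect p.2 \in herm_point q by rewrite -pq memv_line.
  case/vlineP=> c ->; rewrite formZl mulf_eq0 form_gvect_eq0.
  by case/andP: (allP point_table_isotropic_check _ q_tab) => _ ->; rewrite orbT.
move=> P [dimP P_iso].
have P0 : P != 0%VS by rewrite -dimv_eq0 dimP.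
have PE : P = <[vpick P]>%VS.
  by apply/esym/eqP; rewrite eqEdim -memvE memv_pick dimP dim_vline vpick0 P0.
have : vpick P != 0 by rewrite vpick0.
case/gnormalizedP=> c c0 [x x_norm v_x].
have {}PE : P = <[gvect x]>%VS by rewrite PE v_x line_gvect.
have x_iso : gform x x == g0.
  by rewrite -form_gvect_eq0 P_iso ?PE ?memv_line ?eqxx.
have /implyP/(_ x_iso)/mapP[p p_tab x_p] := allP isotropic_table_check _ x_norm.
by exists p; rewrite /herm_point -?x_p.
Qed.

Lemma herm_incident p n : p \in point_table ->
  herm_block n (herm_point p) <-> gform p.2 n = g0.
Proof.
move=> p_tab; have p_pt := set_bij_homo herm_point_bij p_tab.
rewrite /herm_block /= orthov11 form_gvect_eq0.
by split=> [[_ /eqP] | /eqP].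
Qed.

Hypothesis h_nd : nondegenerate h.

(** For surjectivity, a normal of a non-degenerate [L] is what remains of a vector outside [L] after
    projection onto [L]; it cannot be isotropic, as it would then lie in the radical of [L]. *)
Lemma herm_block_bij :
  set_bij [set` block_normals]%classic (hermitian_blocks h) herm_block.
Proof.
have full0 : \dim {:'rV[K]_3} = 3%N by rewrite dimvf dim_matrix.
have nd := nondeg_on_full h_nd.
split.
- move=> n; rewrite /= mem_filter -form_gvect_eq0 => /andP[n_anis _].
  (* The intersection with the full space brings n^perp into the form handled by the Gram-Schmidt
     lemmas. *)
  exists (orthov h <[gvect n]>) => //=; rewrite -[orthov h _]capfv; split.
    by rewrite dim_perp ?memvf // full0.
  apply/eqP; rewrite -subv0; apply/subvP => w.
  rewrite memv_cap => /andP[wL /mem_orthovP w0]; rewrite memv0; apply/eqP.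
  exact: (nondeg_on_perp n_anis (memvf _) nd).
- move=> n m; rewrite !inE => n_bl m_bl nm.
  have /allP/(_ _ m_bl)/implyP := allP block_inj_check _ n_bl.
  move=> nm_inj; apply/esym/eqP/nm_inj/allP => p.
  rewrite mem_filter => /andP[/eqP pn p_tab]; apply/eqP.
  by apply/(herm_incident _ p_tab); rewrite -nm; apply/herm_incident.
move=> _ [L [dimL L_nd] <-].
have ndL : nondeg_on L.
  move=> w wL w0; apply/eqP; rewrite -memv0 -L_nd memv_cap wL.
  exact/mem_orthovP.
have [|f [fL hff ndf dimf Pf]] := split_unit ndL.
  by rewrite -dimv_eq0 dimL.
have [|f' [f'Lf hf'f' _ dimf' Pf']] := split_unit ndf.
  by rewrite -dimv_eq0 dimf dimL.
have /eqP := dimf'; rewrite dimf dimL dimv_eq0 => /eqP Lff'0.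
have LE u : u \in L -> u = h u f *: f + h u f' *: f'.
  move=> /Pf/[dup]/Pf'; rewrite Lff'0 memv0.
  move: f'Lf; rewrite memv_cap mem_orthov1 => /andP[_ /eqP f'f].
  rewrite -scaleNr formDl formZl [h f f']formC f'f rmorph0 mulr0 addr0 scaleNr.
  by rewrite -addrA -opprD subr_eq0 => /eqP.
have [f'L f'f] : f' \in L /\ h f' f = 0.
  by move: f'Lf; rewrite memv_cap mem_orthov1 => /andP[-> /eqP].
have ff' : h f f' = 0 by rewrite formC f'f rmorph0.
have [v _ vL] : exists2 v, v \in fullv & v \notin L.
  by apply/subvPn; apply/negP => /dimvS; rewrite full0 dimL.
pose n := v - (h v f *: f + h v f' *: f').
have n0 : n != 0.
  by apply: contraNneq vL => /subr0_eq ->; rewrite memvD ?memvZ.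
have h_n g : h n g = h v g - (h v f * h f g + h v f' * h f' g).
  by rewrite /n -scaleN1r formDl formZl formDl !formZl mulN1r.
have nL u : u \in L -> h u n = 0.
  move=> /LE ->; rewrite formC formDr !formZr !h_n hff hf'f' ff' f'f.
  by rewrite !mulr0 !mulr1 addr0 add0r !subrr !mulr0 addr0 rmorph0.
(* Both sides have dimension 2, so the inclusion of L in n^perp suffices. *)
have {LE} L_n : L = orthov h <[n]>.
  apply/eqP; rewrite eqEdim dimL -[orthov h _]capfv.
  rewrite -eq_dim_orthov1 ?full0 ?leqnn ?andbT.
    by apply/subvP => u /nL nu; rewrite memv_cap memvf mem_orthov1 nu eqxx.
  by apply/negP; rewrite (eqP h_nd) memv0 (negPf n0).
have n_anis : h n n != 0.
  apply: contra_neq n0 => nn0; apply: ndL.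
    by rewrite L_n mem_orthov1 nn0 eqxx.
  by move=> u /nL nu; rewrite formC nu rmorph0.
have [c c0 [x x_norm n_x]] := gnormalizedP n0.
exists x.
  rewrite /= mem_filter x_norm andbT -form_gvect_eq0.
  by apply: contraNneq n_anis => xx0; rewrite n_x formZl formZr xx0 !mulr0.
by rewrite /herm_block L_n n_x line_gvect.
Qed.

End HermitianPlane.

(** * F_9 as a quadratic extension of F_3 *)

Section QuadraticExtension.
Variable K : splittingFieldType 'F_3.
Hypothesis dimK : \dim {:K} = 2%N.

Lemma F3_cases (c : 'F_3) : [\/ c = 0, c = 1 | c = -1].
Proof.
case: c => [[|[|[|//]]] c_lt]; [constructor 1 | constructor 2 | constructor 3];
  exact: val_inj.
Qed.

Lemma char3 : 1 + 1 + 1 = 0 :> K.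
Proof.
have F3_0 : 1 + 1 + 1 = 0 :> 'F_3 by apply: val_inj.
by rewrite -(scale1r (1 : K)) -!scalerDl F3_0 scale0r.
Qed.

Lemma scalar_trit_val (c : 'F_3) : exists t, c%:A = trit_val K t.
Proof.
case: (F3_cases c) => ->.
- by exists None; rewrite scale0r.
- by exists (Some false); rewrite scale1r.
by exists (Some true); rewrite scaleN1r.
Qed.

Lemma imaginary_unit :
  exists2 i : K, i * i = -1 & forall a, exists x, a = gf9_val i x.
Proof.
have [x _ x1] : exists2 x : K, x \in fullv & x \notin 1%VS.
  by apply/subvPn; apply/negP => /dimvS; rewrite dimK dimv1.
have x_0 : x != 0 by apply: contraNneq x1 => ->; rewrite mem0v.
have free_x1 : free [:: x; 1].
  by rewrite free_cons span_seq1 x1 seq1_free oner_neq0.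
have spanK : <<[:: x; 1%R]>>%VS = {:K}%VS.
  by apply/eqP; rewrite eqEdim subvf dimK (eqP free_x1).
have coordK y : exists a b : 'F_3, y = a *: x + b%:A.
  have : y \in <<[:: x; 1%R]>>%VS by rewrite spanK memvf.
  rewrite span_cons span_seq1.
  case/memv_addP=> [_ /vlineP[a ->] [_ /vlineP[b ->] ->]].
  by exists a, b.
have [a [b xx]] := coordK (x * x).
(* Completing the square in x^2 = a x + b: modulo 3, - a / 2 is a, and i^2 = b + a^2 lies in F_3. *)
pose i := x + a%:A.
have i1 : i \notin 1%VS by rewrite rpredDr // rpredZ // memv_line.
have ii : i * i = (b + a * a)%:A.
  rewrite scalerDl -scalerA -[a *: a%:A]mulr_algl.
  have -> : i * i = x * x + (1 + 1) * (a%:A * x) + a%:A * a%:A.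
    by rewrite /i; ring.
  rewrite xx -[a *: x]mulr_algl.
  transitivity ((1 + 1 + 1) * (a%:A * x) + (b%:A + a%:A * a%:A)); first by ring.
  by rewrite char3 mul0r add0r.
have i_sqr : i * i = -1.
  (* The values 0 and 1 of i^2 would put i into F_3, which leaves -1. *)
  rewrite ii; case: (F3_cases (b + a * a)) ii => ->.
  - rewrite scale0r => /eqP; rewrite mulf_eq0 orbb => /eqP i0.
    by rewrite i0 mem0v in i1.
  - rewrite scale1r => /eqP; rewrite -expr2 sqrf_eq1 => /orP[]/eqP i_1;
      by rewrite i_1 ?rpredN mem1v in i1.
  by rewrite scaleN1r.
exists i => // y; have [c [d ->]] := coordK y.
have [t c_t] := scalar_trit_val c.
(* Substituting x = i - a gives c x + d = (d - c a) + c i. *)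
have [s d_s] := scalar_trit_val (d - c * a).
exists (s, t); rewrite /gf9_val /= -c_t -d_s mulr_algl /i scalerDr scalerA.
by rewrite scalerBl [RHS]addrC -addrA [X in _ = _ + X]addrC subrK.
Qed.

(** As theta preserves i^2 = -1, it maps i to i or - i. In the first case it would fix every s + t
    i, but a generator of a group of order 2 is not the identity. *)
Lemma generator_imaginary (theta : gal_of {:K}) (i : K) :
  generator 'Gal({:K} / 1)%g theta -> i * i = -1 ->
  (forall a, exists x, a = gf9_val i x) -> theta i = - i.
Proof.
move=> gen_theta i_sqr surj.
have : (theta i - i) * (theta i + i) == 0.
  by rewrite -subr_sqr !expr2 -rmorphM i_sqr rmorphN rmorph1 subrr.
rewrite mulf_eq0 subr_eq0 addr_eq0 => /orP[/eqP theta_i|/eqP //].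
have theta1 : theta = 1%g.
  apply/eqP/gal_eqP => a _; rewrite gal_id.
  have [[s t] ->] := surj a; rewrite /gf9_val rmorphD rmorphM /= theta_i.
  have fix_t r : theta (trit_val K r) = trit_val K r.
    by case: r => [b|] /=; rewrite ?rmorph_sign ?rmorph0.
  by rewrite !fix_t.
have := galois_dim (finField_galois (sub1v {:K})).
have /eqP -> := gen_theta.
by rewrite theta1 cycle1 cards1 dimK dimv1.
Qed.

End QuadraticExtension.

Theorem theorem6p4 (K : splittingFieldType 'F_3) (dimK : \dim {:K} = 2%N)
    (theta : gal_of {:K}) (gen_theta : generator 'Gal({:K} / 1)%g theta)
    (h : {hermitian_sym 'rV[K]_3 for theta}) (h_nondeg : nondegenerate h) :
  isomorphic (octU 'F_2) (hermitian_unital h).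
Proof.
have [i i_sqr surj] := imaginary_unit dimK.
have theta_i := generator_imaginary dimK gen_theta i_sqr surj.
have [e1 [e2 [e3 [e_unit e_orth e_basis]]]] :=
  orthonormal_basis (char3 K) i_sqr theta_i surj h_nondeg.
apply: (@isomorphic_param (octU 'F_2) (hermitian_unital h) _ _ _ _ _ _ _ _
  octD_bij (herm_point_bij (char3 K) i_sqr theta_i surj e_unit e_orth e_basis)
  octX_bij (herm_block_bij (char3 K) i_sqr theta_i surj e_unit e_orth e_basis
              h_nondeg)).
(* Both incidences amount to the vanishing of [gform p.2 n]. *)
move=> p n p_tab n_bl; rewrite incident_octU //.
apply: iff_sym.
exact: (herm_incident (char3 K) i_sqr theta_i surj e_unit e_orth e_basis).
Qed.
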